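(* Let $W=W_{D_n}$ and let $M$ be a $(\mathcal C_{2n}\rtimes\mathbb C W)$-module. The action of $y_i$ on the $\mathbb H^{cc}_W$-module $\mathbb C[x_1,\dots,x_n]\otimes M$ is realized as the following Dunkl operator: for any $f\in\mathbb C[x_1,\dots,x_n]$ and $m\in M$, $$\begin{aligned}y_i\circ(f\otimes m)={}&tc_ie_i\frac{f-f^{\tau_i}}{2x_i}\otimes m-u\sum_{k\ne i}\left(\frac{f-f^{s_{ki}}}{x_i-x_k}+\frac{f-f^{\overline s_{ki}}}{x_i+x_k}c_kc_i\right)\otimes(1+e_ke_i)s_{ki}m\\&-u\sum_{k\ne i}\left(\frac{f-f^{\overline s_{ki}}}{x_i+x_k}-\frac{f-f^{s_{ki}}}{x_i-x_k}c_kc_i\right)\otimes(1-e_ke_i)\overline s_{ki}m.\end{aligned}$$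
   Context: All algebras are over $\mathbb C$; $[x,y]=xy-yx$. $W_{D_n}$ is the group of even signed permutations of $1,\dots,n$, a subgroup of the group of all signed permutations; $s_{ij}$ is the transposition of $i,j$, $\overline s_{ij}$ the transposition of $i,j$ coupled with sign changes at $i,j$, $\tau_i$ the sign change at $i$ (not in $W_{D_n}$). Signed permutations act on the span of symbols $a_1,\dots,a_n$ ($a=x,y,c,e$), $a_i\mapsto a_i^\sigma$: $s_{ij}$ swaps $a_i,a_j$; $\overline s_{ij}$ sends $a_i\mapsto-a_j$, $a_j\mapsto-a_i$; $\tau_i$ sends $a_i\mapsto-a_i$; other symbols are fixed. $f\mapsto f^\sigma$ is the induced action on polynomials in $x_1,\dots,x_n$. $\mathcal C_{2n}$ is the Clifford algebra generated by pairwise anticommuting $c_1,\dots,c_n,e_1,\dots,e_n$ of square $1$; $\mathcal C_{2n}\rtimes\mathbb C W$ is the smash product ($\sigma c_i=c_i^\sigma\sigma$, $\sigma e_i=e_i^\sigma\sigma$). Let $t,u\in\mathbb C$. $\mathbb H^{cc}_W$ (type $D_n$) is generated by $x_i,y_i$ ($1\le i\le n$), $\mathcal C_{2n}$ and $W$ subject to, for all $i,j$, $\sigma\in W$: $x_ix_j=x_jx_i$, $y_iy_j=y_jy_i$, $\sigma a_i=a_i^\sigma\sigma$ for $a=c,e,x,y$, $e_ix_j=x_je_i$, $c_ix_j=(-1)^{\delta_{ij}}x_jc_i$, $c_iy_j=y_jc_i$, $e_iy_j=(-1)^{\delta_{ij}}y_je_i$, and $[y_i,x_j]=u(1+c_ic_j)(1+e_je_i)s_{ij}-u(1-c_ic_j)(1-e_je_i)\overline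 s_{ij}$ ($i\ne j$), $[y_i,x_i]=tc_ie_i-u\sum_{k\ne i}(1+c_kc_i)(1+e_ke_i)s_{ki}-u\sum_{k\ne i}(1-c_kc_i)(1-e_ke_i)\overline s_{ki}$. The module: let $\mathfrak H_y\subset\mathbb H^{cc}_W$ be the subalgebra generated by $\mathcal C_{2n}\rtimes\mathbb C W$ and $y_1,\dots,y_n$. Extend $M$ to an $\mathfrak H_y$-module by letting each $y_i$ act by $0$, and form the induced module $\mathrm{Ind}_{\mathfrak H_y}^{\mathbb H^{cc}_W}M$, identified as a vector space with $\mathbb C[x_1,\dots,x_n]\otimes M$ ($f\otimes m$ corresponding to $f\cdot m$). Conventions in the formula: products of polynomials and elements of $\mathcal C_{2n}$ are taken using the relations of $\mathbb H^{cc}_W$, and for a polynomial $p$ and $b\in\mathcal C_{2n}$ one sets $pb\otimes m=p\otimes bm$. *)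

(* Defs.v *)
From HB Require Import structures.
From mathcomp Require Import all_boot all_order all_algebra all_fingroup.
From mathcomp Require Import generic_quotient ring_quotient.
From mathcomp Require Import boolp classical_sets reals complex.
From mathcomp Require Import ssrcomplements freeg mpoly.
From mathcomp Require Import (canonicals,coercions) monalg.

Set Implicit Arguments.
Unset Strict Implicit.
Unset Printing Implicit Defensive.

Import GRing.Theory.

Local Open Scope ring_scope.
Local Open Scope quotient_scope.

Notation free_alg K G := (@monalg.malg (monalg.fmonom G) K).

(* [palg rel] is the quotient of the free algebra on G by the two-sided ideal
   generated by the a - b such that [rel a b]. *)
Section PresentedAlgebra.
Variables (K : fieldType) (G : choiceType).

Local Notation free_alg := (free_alg K G).

Definition free_gen (g : G) : free_alg := monalg.mkmalgU (monalg.fmu g) 1.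

Variable rel : free_alg -> free_alg -> Prop.

Inductive rel_ideal : free_alg -> Prop :=
| rel_ideal_rel a b : rel a b -> rel_ideal (a - b)
| rel_ideal0 : rel_ideal 0
| rel_idealB a b : rel_ideal a -> rel_ideal b -> rel_ideal (a - b)
| rel_idealM a b c : rel_ideal b -> rel_ideal (a * b * c).

Definition in_ideal : {pred free_alg} := fun a => `[< rel_ideal a >].

Fact in_ideal_zmod : zmod_closed in_ideal.
Proof.
split=> [|a b /asboolP Ia /asboolP Ib]; apply/asboolP; first exact: rel_ideal0.
exact: rel_idealB.
Qed.
HB.instance Definition _ := GRing.isZmodClosed.Build free_alg in_ideal
  in_ideal_zmod.

(* Only a [pzRingType]: nothing excludes 1 = 0 for an arbitrary [rel]. *)
Definition palg := Quotient.quot in_ideal.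
HB.instance Definition _ := GRing.Zmodule.on palg.

Definition palg_mul (a b : palg) : palg := \pi_palg (repr a * repr b).
Definition palg_one : palg := \pi_palg 1.

Fact palg_eqP (a b : free_alg) :
  reflect (\pi_palg a = \pi_palg b) (a - b \in in_ideal).
Proof.
by apply: (iffP idP); [rewrite Quotient.idealrBE => /eqP
                      | move/eqP; rewrite Quotient.idealrBE].
Qed.

Fact pi_palgM (a b : free_alg) :
  \pi_palg (a * b) = palg_mul (\pi_palg a) (\pi_palg b).
Proof.
have Ir x : rel_ideal (x - repr (\pi_palg x)).
  by apply/asboolP/palg_eqP; rewrite reprK.
apply/palg_eqP/asboolP.
have -> : a * b - repr (\pi_palg a) * repr (\pi_palg b) =
  1 * (a - repr (\pi_palg a)) * b
  - (0 - repr (\pi_palg a) * (b - repr (\pi_palg b)) * 1).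
  by rewrite mul1r mulr1 sub0r opprK mulrBl mulrBr addrA subrK.
apply: rel_idealB; first exact: rel_idealM.
by apply: rel_idealB; [exact: rel_ideal0 | exact: rel_idealM].
Qed.

Fact pi_palgD (a b : free_alg) :
  \pi_palg (a + b) = \pi_palg a + \pi_palg b :> palg.
Proof. by rewrite !piE. Qed.

Fact palg_mulA : associative palg_mul.
Proof.
elim/quotW=> a; elim/quotW=> b; elim/quotW=> c.
by rewrite -(pi_palgM b c) -(pi_palgM a b) -(pi_palgM a) -(pi_palgM (a * b)) mulrA.
Qed.
Fact palg_mul1 : left_id palg_one palg_mul.
Proof. by elim/quotW=> a; rewrite -pi_palgM mul1r. Qed.
Fact palg_1mul : right_id palg_one palg_mul.
Proof. by elim/quotW=> a; rewrite -pi_palgM mulr1. Qed.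
Fact palg_mulDl : left_distributive palg_mul +%R.
Proof.
elim/quotW=> a; elim/quotW=> b; elim/quotW=> c.
rewrite -(pi_palgD a) -(pi_palgM a) -(pi_palgM b) -(pi_palgM (a + b)).
by rewrite mulrDl pi_palgD.
Qed.
Fact palg_mulDr : right_distributive palg_mul +%R.
Proof.
elim/quotW=> a; elim/quotW=> b; elim/quotW=> c.
rewrite -(pi_palgD b) -(pi_palgM a b) -(pi_palgM a c) -(pi_palgM a (b + c)).
by rewrite mulrDr pi_palgD.
Qed.
HB.instance Definition _ := GRing.Zmodule_isPzRing.Build palg
  palg_mulA palg_mul1 palg_1mul palg_mulDl palg_mulDr.

Definition palg_pi (a : free_alg) : palg := \pi_palg a.
Fact palg_pi_zmod : zmod_morphism palg_pi.
Proof. by move=> a b; rewrite /palg_pi !piE. Qed.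
Fact palg_pi_monoid : monoid_morphism palg_pi.
Proof. by split; [exact: erefl | exact: pi_palgM]. Qed.
HB.instance Definition _ :=
  GRing.isZmodMorphism.Build free_alg palg palg_pi palg_pi_zmod.
HB.instance Definition _ :=
  GRing.isMonoidMorphism.Build free_alg palg palg_pi palg_pi_monoid.

Lemma palg_pi_rel a b : rel a b -> palg_pi a = palg_pi b.
Proof. by move=> ab; apply/palg_eqP/asboolP/rel_ideal_rel. Qed.

Definition palg_gen (g : G) : palg := palg_pi (free_gen g).

(* The structure morphism making [palg] a K-algebra. *)
Definition palgC (k : K) : palg := palg_pi (k%:A).
Fact palgC_zmod : zmod_morphism palgC.
Proof. by move=> a b; rewrite /palgC scalerBl raddfB. Qed.
Fact palgC_monoid : monoid_morphism palgC.
Proof.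
split=> [|a b]; first by rewrite /palgC scale1r rmorph1.
by rewrite /palgC -rmorphM -scalerAl mul1r scalerA.
Qed.
HB.instance Definition _ :=
  GRing.isZmodMorphism.Build K palg palgC palgC_zmod.
HB.instance Definition _ :=
  GRing.isMonoidMorphism.Build K palg palgC palgC_monoid.

Fact free_alg_scalarC (a : free_alg) k : a * k%:A = k *: a.
Proof.
rewrite -monalg.mul_malgC mulr1 monalg.malgM_def monalg.fgmulgU.
rewrite [in RHS](monalg.monalgE a) scaler_sumr; apply: eq_bigr => m _.
apply/monalg.malgP=> l; rewrite monalg.mulm1 mulrC monalg.mcoeffZ.
by rewrite !monalg.mcoeffU mulrnAr.
Qed.
Lemma palgC_central k (a : palg) : palgC k * a = a * palgC k.
Proof.
elim/quotW: a => a; rewrite -[\pi_palg a]/(palg_pi a) /palgC -!rmorphM /=.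
by rewrite free_alg_scalarC -scalerAl mul1r.
Qed.

End PresentedAlgebra.

Section Restriction.
Variables (S T : pzRingType).

Definition restr_scal of {rmorphism S -> T} := fun N : lmodType T => N : Type.

Variables (j : {rmorphism S -> T}) (N : lmodType T).
Local Notation restr := (restr_scal j N).

HB.instance Definition _ := GRing.Zmodule.copy restr N.

Definition restr_scale (s : S) (v : restr) : restr := j s *: (v : N).
Fact restr_scaleA a b v :
  restr_scale a (restr_scale b v) = restr_scale (a * b) v.
Proof. by rewrite /restr_scale rmorphM scalerA. Qed.
Fact restr_scale1 : left_id 1 restr_scale.
Proof. by move=> v; rewrite /restr_scale rmorph1 scale1r. Qed.
Fact restr_scaleDr : right_distributive restr_scale +%R.
Proof. by move=> a v w; rewrite /restr_scale scalerDr. Qed.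
Fact restr_scaleDl v : {morph restr_scale^~ v : a b / a + b}.
Proof. by move=> a b; rewrite /restr_scale rmorphD scalerDl. Qed.
HB.instance Definition _ := GRing.Zmodule_isLmodule.Build S restr
  restr_scaleA restr_scale1 restr_scaleDr restr_scaleDl.

End Restriction.

(* [ext_scal j N] is the left T-module T (x)_S N, for T a right S-module along
   the ring morphism j : S -> T. *)
Section Extension.
Variables (S T : pzRingType) (j : {rmorphism S -> T}) (N : lmodType S).

Inductive tensor_rel : {freeg (T * N)%type / int} -> Prop :=
| tensor_relDl a b v :
    tensor_rel (<< (a + b, v) >> - (<< (a, v) >> + << (b, v) >>))
| tensor_relDr a v w :
    tensor_rel (<< (a, v + w) >> - (<< (a, v) >> + << (a, w) >>))
| tensor_relS a s v : tensor_rel (<< (a * j s, v) >> - << (a, s *: v) >>)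
| tensor_rel0 : tensor_rel 0
| tensor_relB x y : tensor_rel x -> tensor_rel y -> tensor_rel (x - y).

Definition in_tensor_rel : {pred {freeg (T * N)%type / int}} :=
  fun x => `[< tensor_rel x >].

Fact in_tensor_rel_zmod : zmod_closed in_tensor_rel.
Proof.
split=> [|x y /asboolP Ix /asboolP Iy]; apply/asboolP; first exact: tensor_rel0.
exact: tensor_relB.
Qed.
HB.instance Definition _ :=
  GRing.isZmodClosed.Build _ in_tensor_rel in_tensor_rel_zmod.

Definition ext_scal := Quotient.quot in_tensor_rel.
HB.instance Definition _ := GRing.Zmodule.on ext_scal.

Definition tensor (a : T) (v : N) : ext_scal := \pi_ext_scal << (a, v) >>.

Fact pi_ext_scalB x y :
  \pi_ext_scal (x - y) = \pi_ext_scal x - \pi_ext_scal y :> ext_scal.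
Proof. by rewrite !piE. Qed.
Fact pi_ext_scalD x y :
  \pi_ext_scal (x + y) = \pi_ext_scal x + \pi_ext_scal y :> ext_scal.
Proof. by rewrite !piE. Qed.

Fact ext_scal_eqP x y :
  reflect (\pi_ext_scal x = \pi_ext_scal y) (x - y \in in_tensor_rel).
Proof.
by apply: (iffP idP); [rewrite Quotient.idealrBE => /eqP
                      | move/eqP; rewrite Quotient.idealrBE].
Qed.

Lemma tensorDl a b v : tensor (a + b) v = tensor a v + tensor b v.
Proof.
by rewrite /tensor -pi_ext_scalD; apply/ext_scal_eqP/asboolP/tensor_relDl.
Qed.
Lemma tensorDr a v w : tensor a (v + w) = tensor a v + tensor a w.
Proof.
by rewrite /tensor -pi_ext_scalD; apply/ext_scal_eqP/asboolP/tensor_relDr.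
Qed.
Lemma tensorS a s v : tensor (a * j s) v = tensor a (s *: v).
Proof. by apply/ext_scal_eqP/asboolP/tensor_relS. Qed.

Lemma tensor0r a : tensor a 0 = 0.
Proof. by apply: (addIr (tensor a 0)); rewrite -tensorDr !add0r. Qed.

Section Lift.
Variables (Z : zmodType) (beta : T -> N -> Z).

Definition pre_lift : {freeg (T * N)%type / int} -> zmodule Z :=
  fglift (fun p => beta p.1 p.2 : zmodule Z).
Fact pre_lift_zmod : zmod_morphism pre_lift.
Proof. exact: lift_is_additive. Qed.
HB.instance Definition _ :=
  GRing.isZmodMorphism.Build _ (zmodule Z) pre_lift pre_lift_zmod.
Fact pre_liftU a v : pre_lift << (a, v) >> = beta a v.
Proof. by rewrite /pre_lift liftU scale1r. Qed.

Definition tensor_lift (x : ext_scal) : Z := pre_lift (repr x).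

Hypotheses (betaDl : forall a b v, beta (a + b) v = beta a v + beta b v)
           (betaDr : forall a v w, beta a (v + w) = beta a v + beta a w)
           (betaS : forall a s v, beta (a * j s) v = beta a (s *: v)).

Fact pre_lift_rel x : tensor_rel x -> pre_lift x = 0.
Proof.
elim=> [a b v|a v w|a s v||y z _ IHy _ IHz].
- by rewrite raddfB raddfD /= !pre_liftU betaDl; exact: subrr.
- by rewrite raddfB raddfD /= !pre_liftU betaDr; exact: subrr.
- by rewrite raddfB /= !pre_liftU betaS; exact: subrr.
- by rewrite raddf0.
- by rewrite raddfB /= IHy IHz subrr.
Qed.

Fact tensor_lift_pi x : tensor_lift (\pi_ext_scal x) = pre_lift x.
Proof.
apply/eqP; rewrite -subr_eq0; apply/eqP.
rewrite -[LHS](raddfB pre_lift); apply: pre_lift_rel.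
by apply/asboolP/ext_scal_eqP; rewrite reprK.
Qed.

Lemma tensor_liftE a v : tensor_lift (tensor a v) = beta a v.
Proof. by rewrite tensor_lift_pi pre_liftU. Qed.

Lemma tensor_liftB : zmod_morphism tensor_lift.
Proof.
elim/quotW=> x; elim/quotW=> y.
by rewrite -pi_ext_scalB !tensor_lift_pi raddfB.
Qed.

End Lift.

Lemma tensor_ind (P : ext_scal -> Prop) :
  P 0 -> (forall a v, P (tensor a v)) -> (forall x y, P x -> P y -> P (x - y)) ->
  forall x, P x.
Proof.
move=> P0 Pt PB; elim/quotW=> x; rewrite -(freeg_sumE x).
have PD y z : P y -> P z -> P (y + z).
  by move=> Py Pz; rewrite -[z]opprK -[- z]sub0r; apply: (PB) => //; exact: PB.
have pi0 : \pi_ext_scal 0 = 0 :> ext_scal.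
  by have := pi_ext_scalB 0 0; rewrite !subrr.
elim/big_ind: _ => [|y z|[a v] _]; first by rewrite pi0.
- by rewrite pi_ext_scalD; exact: PD.
have PMn k : P (\pi_ext_scal << k%:Z *g (a, v) >>).
  elim: k => [|k IHk]; first by rewrite freegU0 pi0.
  by rewrite intS -freegUD pi_ext_scalD; apply: PD => //; exact: Pt.
case: (coeff _ x) => k; first exact: PMn.
by rewrite NegzE -freegUN -[- _]sub0r pi_ext_scalB pi0; apply: PB.
Qed.

Definition ext_act (t : T) : ext_scal -> ext_scal :=
  tensor_lift (fun a v => tensor (t * a) v).

Fact ext_actE t a v : ext_act t (tensor a v) = tensor (t * a) v.
Proof.
rewrite /ext_act tensor_liftE // => [b c w|b w y|b s w].
- by rewrite mulrDr tensorDl.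
- by rewrite tensorDr.
- by rewrite mulrA tensorS.
Qed.
Fact ext_actB t : zmod_morphism (ext_act t).
Proof.
apply: tensor_liftB => [b c w|b w y|b s w].
- by rewrite mulrDr tensorDl.
- by rewrite tensorDr.
- by rewrite mulrA tensorS.
Qed.
HB.instance Definition _ t :=
  GRing.isZmodMorphism.Build _ _ (ext_act t) (ext_actB t).

Fact ext_actA s t x : ext_act s (ext_act t x) = ext_act (s * t) x.
Proof.
elim/tensor_ind: x => [|a v|x y IHx IHy]; first by rewrite !raddf0.
- by rewrite !ext_actE mulrA.
- by rewrite !raddfB /= IHx IHy.
Qed.
Fact ext_act1 : left_id 1 ext_act.
Proof.
elim/tensor_ind=> [|a v|x y IHx IHy]; first by rewrite raddf0.
- by rewrite ext_actE mul1r.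
- by rewrite raddfB /= IHx IHy.
Qed.
Fact ext_actDr : right_distributive ext_act +%R.
Proof. by move=> t x y; rewrite raddfD. Qed.
Fact ext_actDl x : {morph ext_act^~ x : s t / s + t}.
Proof.
move=> s t; elim/tensor_ind: x => [|a v|x y IHx IHy].
- by rewrite !raddf0 addr0.
- by rewrite !ext_actE mulrDl tensorDl.
- by rewrite !raddfB /= IHx IHy opprD addrACA.
Qed.
HB.instance Definition _ := GRing.Zmodule_isLmodule.Build T ext_scal
  ext_actA ext_act1 ext_actDr ext_actDl.

Lemma tensorZ t a v : t *: tensor a v = tensor (t * a) v.
Proof. exact: ext_actE. Qed.

End Extension.

Record sperm n := SPerm { sp_perm : {perm 'I_n}; sp_sign : {ffun 'I_n -> bool} }.
Arguments SPerm {n}.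

Section SignedPermutations.
Variable n : nat.

Fact sperm_pairK :
  cancel (fun s : sperm n => (sp_perm s, sp_sign s)) (fun p => SPerm p.1 p.2).
Proof. by case. Qed.
HB.instance Definition _ := Finite.copy (sperm n) (can_type sperm_pairK).

(* [s] sends a_i to (-1)^(sp_sign s i) a_(sp_perm s i), and [sperm_mul s r] is
   "first r, then s", so that (s r) a_i = a_i^(s r) (s r) in the smash product;
   the product of {perm _} is in the opposite order. *)
Definition sperm_mul (s r : sperm n) : sperm n :=
  SPerm (sp_perm r * sp_perm s)%g
        [ffun i => sp_sign r i (+) sp_sign s (sp_perm r i)].
Definition sperm_one : sperm n := SPerm 1%g [ffun=> false].
Definition sperm_inv (s : sperm n) : sperm n :=
  SPerm (sp_perm s)^-1%g [ffun i => sp_sign s ((sp_perm s)^-1%g i)].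

Fact sperm_mulA : associative sperm_mul.
Proof.
move=> s r q; congr SPerm; rewrite /= ?mulgA //.
by apply/ffunP=> i; rewrite !ffunE /= permM addbA.
Qed.
Fact sperm_mul1 : left_id sperm_one sperm_mul.
Proof.
case=> p e; congr SPerm; rewrite /= ?mulg1 //.
by apply/ffunP=> i; rewrite !ffunE addbF.
Qed.
Fact sperm_mulV : left_inverse sperm_one sperm_inv sperm_mul.
Proof.
case=> p e; congr SPerm; rewrite /= ?mulgV //.
by apply/ffunP=> i; rewrite !ffunE permK addbb.
Qed.
HB.instance Definition _ :=
  Finite_isGroup.Build (sperm n) sperm_mulA sperm_mul1 sperm_mulV.

Definition s_ (i j : 'I_n) : sperm n := SPerm (tperm i j) [ffun=> false].
Definition sbar_ (i j : 'I_n) : sperm n :=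
  SPerm (tperm i j) [ffun k => k \in [set i; j]].
Definition tau_ (i : 'I_n) : sperm n := SPerm 1%g [ffun k => k == i].

Definition WD_set : {set sperm n} :=
  [set s | ~~ odd #|[set i | sp_sign s i]|].

Fact odd_signs (e : 'I_n -> bool) :
  odd #|[set i | e i]| = \big[addb/false]_i e i.
Proof.
rewrite cardsE -sum1_card big_mkcond /= (big_morph odd oddD (erefl _)).
by apply: eq_bigr => i _; rewrite unfold_in; case: (e i).
Qed.

Fact WD_group_set : group_set WD_set.
Proof.
apply/group_setP; split=> [|s r].
  by rewrite inE odd_signs big1 // => i _; rewrite ffunE.
rewrite !inE !odd_signs => /negbTE Es /negbTE Er.
under eq_bigr do rewrite ffunE.
rewrite big_split /= Er /=.
by move: Es; rewrite (reindex_inj (@perm_inj _ (sp_perm r))) => ->.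
Qed.
Canonical WD_group : {group sperm n} := Group WD_group_set.

Definition WD := subg_of WD_group.

Lemma s_in_WD i j : s_ i j \in WD_group.
Proof. by rewrite inE odd_signs big1 // => k _; rewrite ffunE. Qed.
Lemma sbar_in_WD i j : i != j -> sbar_ i j \in WD_group.
Proof.
move=> ij; rewrite inE /=; set A := finset _.
suff -> : A = [set i; j] by rewrite cards2 ij.
by apply/setP=> k; rewrite !inE ffunE !inE.
Qed.

(* [sW i j] and [sbarW i j] are s_ij and sbar_ij as elements of W_{D_n};
   [sbarW i i] is junk (equal to 1) and is never used. *)
Definition sW (i j : 'I_n) : WD := subg WD_group (s_ i j).
Definition sbarW (i j : 'I_n) : WD := subg WD_group (sbar_ i j).

End SignedPermutations.

(* The vector a_i^s, for a family of vectors [a]. *)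
Definition sact (K : pzRingType) (V : lmodType K) n (a : 'I_n -> V)
    (s : sperm n) (i : 'I_n) : V :=
  (-1) ^+ sp_sign s i *: a (sp_perm s i).

Inductive cliffW_gen n := GenC of 'I_n | GenE of 'I_n | GenW of WD n.
HB.instance Definition _ n := gen_eqMixin (cliffW_gen n).
HB.instance Definition _ n := gen_choiceMixin (cliffW_gen n).

Inductive hcc_gen n := GenX of 'I_n | GenY of 'I_n | GenCW of cliffW_gen n.
HB.instance Definition _ n := gen_eqMixin (hcc_gen n).
HB.instance Definition _ n := gen_choiceMixin (hcc_gen n).

Section Relations.
Variables (K : fieldType) (n : nat) (F : lalgType K).

Inductive cliffW_rel (c e : 'I_n -> F) (w : WD n -> F) : F -> F -> Prop :=
| cliffW_cc i : cliffW_rel c e w (c i * c i) 1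
| cliffW_ee i : cliffW_rel c e w (e i * e i) 1
| cliffW_ccN i j : i != j -> cliffW_rel c e w (c i * c j) (- (c j * c i))
| cliffW_eeN i j : i != j -> cliffW_rel c e w (e i * e j) (- (e j * e i))
| cliffW_ceN i j : cliffW_rel c e w (c i * e j) (- (e j * c i))
| cliffW_w1 : cliffW_rel c e w (w 1%g) 1
| cliffW_wM s r : cliffW_rel c e w (w (s * r)%g) (w s * w r)
| cliffW_wc s i : cliffW_rel c e w (w s * c i) (sact c (sgval s) i * w s)
| cliffW_we s i : cliffW_rel c e w (w s * e i) (sact e (sgval s) i * w s).

Inductive hcc_rel (t u : K) (x y c e : 'I_n -> F) (w : WD n -> F) :
  F -> F -> Prop :=
| hcc_cliffW a b : cliffW_rel c e w a b -> hcc_rel t u x y c e w a b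
| hcc_xx i j : hcc_rel t u x y c e w (x i * x j) (x j * x i)
| hcc_yy i j : hcc_rel t u x y c e w (y i * y j) (y j * y i)
| hcc_wx s i : hcc_rel t u x y c e w (w s * x i) (sact x (sgval s) i * w s)
| hcc_wy s i : hcc_rel t u x y c e w (w s * y i) (sact y (sgval s) i * w s)
| hcc_ex i j : hcc_rel t u x y c e w (e i * x j) (x j * e i)
| hcc_cx i j : hcc_rel t u x y c e w (c i * x j) ((-1) ^+ (i == j) *: (x j * c i))
| hcc_cy i j : hcc_rel t u x y c e w (c i * y j) (y j * c i)
| hcc_ey i j : hcc_rel t u x y c e w (e i * y j) ((-1) ^+ (i == j) *: (y j * e i))
| hcc_yx i j : i != j -> hcc_rel t u x y c e w
    (y i * x j - x j * y i)
    (u *: ((1 + c i * c j) * (1 + e j * e i) * w (sW i j))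
     - u *: ((1 - c i * c j) * (1 - e j * e i) * w (sbarW i j)))
| hcc_yx_diag i : hcc_rel t u x y c e w
    (y i * x i - x i * y i)
    (t *: (c i * e i)
     - u *: (\sum_(k | k != i) (1 + c k * c i) * (1 + e k * e i) * w (sW k i))
     - u *: (\sum_(k | k != i)
               (1 - c k * c i) * (1 - e k * e i) * w (sbarW k i))).

End Relations.

Section Algebras.
Variables (K : fieldType) (n : nat).

Definition cliffW_relators :=
  let g := @free_gen K (cliffW_gen n) in
  cliffW_rel (fun i => g (GenC i)) (fun i => g (GenE i)) (fun s => g (GenW s)).

Definition cliffW := palg cliffW_relators.
HB.instance Definition _ := GRing.PzRing.on cliffW.

Definition cC (i : 'I_n) : cliffW := palg_gen cliffW_relators (GenC i).
Definition eC (i : 'I_n) : cliffW := palg_gen cliffW_relators (GenE i).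
Definition wC (s : WD n) : cliffW := palg_gen cliffW_relators (GenW s).

Variables t u : K.

Definition hcc_relators :=
  let g := @free_gen K (hcc_gen n) in
  hcc_rel t u (fun i => g (GenX i)) (fun i => g (GenY i))
    (fun i => g (GenCW (GenC i))) (fun i => g (GenCW (GenE i)))
    (fun s => g (GenCW (GenW s))).

Definition hcc := palg hcc_relators.
HB.instance Definition _ := GRing.PzRing.on hcc.

Definition xH (i : 'I_n) : hcc := palg_gen hcc_relators (GenX i).
Definition yH (i : 'I_n) : hcc := palg_gen hcc_relators (GenY i).
Definition cwH (g : cliffW_gen n) : hcc := palg_gen hcc_relators (GenCW g).

End Algebras.

Arguments cliffW_relators K n : clear implicits.
Arguments hcc_relators {K} n t u.

Section DividedDifferences.
Variables (K : fieldType) (n : nat).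
Implicit Types (f d q : {mpoly K[n]}) (s : sperm n).

Definition pact s f : {mpoly K[n]} :=
  f \mPo [tuple sact (fun j => 'X_j : {mpoly K[n]}) s i | i < n].

(* The exact quotient f / d of polynomials; 0 if d does not divide f. *)
Definition mquo f d : {mpoly K[n]} := xget 0 [set q | q * d = f]%classic.

Lemma mquoK f d q : d != 0 -> q * d = f -> mquo f d = q.
Proof.
move=> d0 qd; apply: (mulIf d0).
by rewrite qd; apply: (@xgetPex _ 0 [set q | q * d = f]%classic); exists q.
Qed.

Lemma pact_dvd s d :
  (forall i, exists q, q * d = 'X_i - sact (fun j => 'X_j : {mpoly K[n]}) s i) ->
  forall f, exists q, q * d = f - pact s f.
Proof.
move=> dX f; elim/mpolyind: f => [|c m f _ _ [q qf]].
  by exists 0; rewrite mul0r /pact comp_mpoly0 subrr.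
pose P g := exists q, q * d = g - pact s g.
suff [r rm] : P 'X_[m].
  exists (c *: r + q); rewrite mulrDl -scalerAl rm qf /pact.
  by rewrite comp_mpolyD comp_mpolyZ scalerBr opprD addrACA.
have PM g h : P g -> P h -> P (g * h).
  move=> [q1 q1g] [q2 q2h]; exists (q1 * h + pact s g * q2).
  rewrite mulrDl mulrAC q1g -mulrA q2h mulrBl mulrBr addrA subrK.
  by rewrite /pact rmorphM.
have P1 : P 1 by exists 0; rewrite mul0r /pact comp_mpoly1 subrr.
rewrite mpolyXE_id; apply: big_ind => [||i _]; [exact: P1 | exact: PM |].
elim: (m i) => [|k IHk]; first exact: P1.
rewrite exprS; apply: PM IHk.
have [r rX] := dX i; exists r; rewrite rX /pact comp_mpolyXU.
by rewrite -tnth_nth tnth_mktuple.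
Qed.

Lemma pact_tau_dvd i f : exists q, q * (2 *: 'X_i) = f - pact (tau_ i) f.
Proof.
apply: pact_dvd => j; rewrite /sact /= perm1 ffunE.
case: eqVneq => [->|_]; last by exists 0; rewrite mul0r scale1r subrr.
by exists 1; rewrite mul1r expr1 scaleN1r opprK scaler_nat mulr2n.
Qed.

Lemma pact_s_dvd i k f :
  exists q, q * ('X_i - 'X_k) = f - pact (s_ k i) f.
Proof.
apply: pact_dvd => j; rewrite /sact /= ffunE scale1r.
case: tpermP => [->|->|_ _]; last by exists 0; rewrite mul0r subrr.
- by exists (-1); rewrite mulN1r opprB.
- by exists 1; rewrite mul1r.
Qed.

Lemma pact_sbar_dvd i k f :
  exists q, q * ('X_i + 'X_k) = f - pact (sbar_ k i) f.
Proof.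
apply: pact_dvd => j; rewrite /sact /= ffunE !inE.
case: tpermP => [->|->|/eqP/negbTE -> /eqP/negbTE ->] /=.
- by exists 1; rewrite eqxx mul1r scaleN1r opprK addrC.
- by exists 1; rewrite eqxx orbT mul1r scaleN1r opprK.
- by exists 0; rewrite mul0r scale1r subrr.
Qed.

End DividedDifferences.

Section InducedModule.
Variables (K : fieldType) (n : nat) (t u : K).
Local Notation H := (hcc n t u).

Inductive Hy_gen : H -> Prop :=
| Hy_C k : Hy_gen (palgC _ k)
| Hy_cw g : Hy_gen (cwH t u g)
| Hy_y i : Hy_gen (yH t u i)
| Hy_B a b : Hy_gen a -> Hy_gen b -> Hy_gen (a - b)
| Hy_M a b : Hy_gen a -> Hy_gen b -> Hy_gen (a * b).

Definition in_Hy : {pred H} := fun a => `[< Hy_gen a >].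

Fact in_Hy_subring : subring_closed in_Hy.
Proof.
split=> [|a b /asboolP Ha /asboolP Hb|a b /asboolP Ha /asboolP Hb].
- by apply/asboolP; rewrite -(rmorph1 (palgC (hcc_relators n t u))); exact: Hy_C.
- by apply/asboolP; exact: Hy_B.
- by apply/asboolP; exact: Hy_M.
Qed.
HB.instance Definition _ := GRing.isSubringClosed.Build H in_Hy in_Hy_subring.

Record Hy := MkHy { Hy_val : H; _ : Hy_val \in in_Hy }.
HB.instance Definition _ := [isSub for Hy_val].
HB.instance Definition _ := [Choice of Hy by <:].
HB.instance Definition _ :=
  GRing.SubChoice_isSubPzRing.Build H in_Hy Hy in_Hy_subring.

Fact HyC_subproof k : palgC (hcc_relators n t u) k \in in_Hy.
Proof. exact/asboolP/Hy_C. Qed.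
Fact cwHy_subproof g : cwH t u g \in in_Hy.
Proof. exact/asboolP/Hy_cw. Qed.
Fact yHy_subproof i : yH t u i \in in_Hy.
Proof. exact/asboolP/Hy_y. Qed.

Definition HyC (k : K) : Hy := MkHy (HyC_subproof k).
Definition cwHy (g : cliffW_gen n) : Hy := MkHy (cwHy_subproof g).
Definition yHy (i : 'I_n) : Hy := MkHy (yHy_subproof i).

Variable M : lmodType (cliffW K n).

(* The H_y-module structures on M that extend the given action of
   C_{2n} >< C W and in which every y_i acts by 0. *)
Record y_extension := YExtension {
  y_act : Hy -> M -> M;
  y_actA : forall a b m, y_act a (y_act b m) = y_act (a * b) m;
  y_act1 : left_id 1 y_act;
  y_actDr : right_distributive y_act +%R;
  y_actDl : forall m, {morph y_act^~ m : a b / a + b};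
  y_act_C : forall k m, y_act (HyC k) m = palgC (cliffW_relators K n) k *: m;
  y_act_cw : forall g m,
    y_act (cwHy g) m = palg_gen (cliffW_relators K n) g *: m;
  y_act_y : forall i m, y_act (yHy i) m = 0
}.

Variable E : y_extension.

Definition y_module of y_extension : Type := M.
HB.instance Definition _ := GRing.Zmodule.on (y_module E).
HB.instance Definition _ := GRing.Zmodule_isLmodule.Build Hy (y_module E)
  (@y_actA E) (@y_act1 E) (@y_actDr E) (@y_actDl E).

Definition Ind : Type := ext_scal (val : {rmorphism Hy -> H}) (y_module E).
HB.instance Definition _ := GRing.Lmodule.on Ind.

Definition ind (m : M) : Ind :=
  tensor (val : {rmorphism Hy -> H}) 1 (m : y_module E).

(* C[x_1, ..., x_n] (x)_C M, with C acting on M through C_{2n} >< C W. *)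
Definition polyM : Type :=
  ext_scal (@mpolyC n K) (restr_scal (palgC (cliffW_relators K n)) M).
HB.instance Definition _ := GRing.Lmodule.on polyM.

Definition ptensor (f : {mpoly K[n]}) (m : M) : polyM :=
  tensor (@mpolyC n K) f
    (m : restr_scal (palgC (cliffW_relators K n)) M).

(* The product c_i e_i f (x) m, rewritten as f^(tau_i) (x) c_i e_i m with the
   relations c_i x_j = (-1)^(i = j) x_j c_i and e_i x_j = x_j e_i of H^cc_W. *)
Definition ce_ptensor (i : 'I_n) (f : {mpoly K[n]}) (m : M) : polyM :=
  ptensor (pact (tau_ i) f) (cC K i * eC K i *: m).

(* The product f b (x) m = f (x) b m, for b in C_{2n} >< C W. *)
Definition ptensor_r (f : {mpoly K[n]}) (b : cliffW K n) (m : M) : polyM :=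
  ptensor f (b *: m).

(* The value f(x_1, ..., x_n) in H^cc_W of a polynomial f. *)
Definition xpoly (f : {mpoly K[n]}) : H :=
  \sum_(m <- msupp f) palgC _ f@_m * \prod_(i < n) xH t u i ^+ m i.

(* The identification of C[x_1, ..., x_n] (x)_C M with the induced module:
   f (x) m is sent to f . (1 (x) m), see [identE]. *)
Definition ident : polyM -> Ind :=
  @tensor_lift _ _ (@mpolyC n K) (restr_scal (palgC (cliffW_relators K n)) M)
    Ind (fun f m => xpoly f *: ind m).

Fact xpolyE d f : (msize f <= d)%N ->
  xpoly f = \sum_(m : 'X_{1..n < d}) palgC _ f@_m * \prod_(i < n) xH t u i ^+ m i.
Proof.
move=> le_fd; rewrite /xpoly; pose I : subFinType _ := 'X_{1..n < d}.
rewrite (big_mksub I) //=; first last.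
  by move=> m /msize_mdeg_lt /leq_trans; apply.
  by rewrite msupp_uniq.
rewrite big_rmcond //= => m /memN_msupp_eq0 ->.
by rewrite rmorph0 mul0r.
Qed.

Fact xpolyD f g : xpoly (f + g) = xpoly f + xpoly g.
Proof.
pose d := maxn (msize (f + g)) (maxn (msize f) (msize g)).
have [h0 h1 h2] : [/\ msize (f + g) <= d, msize f <= d & msize g <= d]%N.
  by rewrite !leq_max !leqnn !orbT.
rewrite !(@xpolyE d) // -big_split /=; apply: eq_bigr => m _.
by rewrite mcoeffD rmorphD mulrDl.
Qed.

Fact xpolyM f k : xpoly (f * k%:MP) = xpoly f * palgC _ k.
Proof.
rewrite mulrC mul_mpolyC.
have le_kf : (msize (k *: f) <= msize f)%N by exact: msizeZ_le.
rewrite (xpolyE le_kf) (xpolyE (leqnn _)) mulr_suml; apply: eq_bigr => m _.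
by rewrite mcoeffZ rmorphM /= -[in RHS]palgC_central mulrA.
Qed.

Fact ind_scale k m : palgC (hcc_relators n t u) k *: ind m =
  ind (palgC (cliffW_relators K n) k *: m).
Proof.
rewrite /ind tensorZ mulr1 -[palgC _ k]mul1r.
by rewrite -(y_act_C E) -[RHS]tensorS.
Qed.

Fact indD m m' : ind (m + m') = ind m + ind m'.
Proof. exact: tensorDr. Qed.

Lemma ind_cw g m :
  cwH t u g *: ind m = ind (palg_gen (cliffW_relators K n) g *: m).
Proof.
by rewrite /ind tensorZ mulr1 -[cwH _ _ _]mul1r -(y_act_cw E) -[RHS]tensorS.
Qed.

Lemma ind_y i m : yH t u i *: ind m = 0.
Proof.
rewrite -[RHS](tensor0r _ _ 1) -(y_act_y E i m) -[RHS]tensorS mul1r.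
by rewrite /ind tensorZ mulr1.
Qed.

Lemma identE f m : ident (ptensor f m) = xpoly f *: ind m.
Proof.
rewrite /ident /ptensor tensor_liftE // => [g h v|g v w|g k v].
- by rewrite xpolyD scalerDl.
- by rewrite indD scalerDr.
- by rewrite xpolyM -scalerA ind_scale.
Qed.

Lemma identB : zmod_morphism ident.
Proof.
apply: tensor_liftB => [g h v|g v w|g k v].
- by rewrite xpolyD scalerDl.
- by rewrite indD scalerDr.
- by rewrite xpolyM -scalerA ind_scale.
Qed.

End InducedModule.

(* Main.v *)
Require Import Defs.
From HB Require Import structures.
From mathcomp Require Import all_boot all_order all_algebra all_fingroup.
From mathcomp Require Import reals complex freeg mpoly.
From mathcomp Require Import (canonicals,coercions) monalg.

Import GRing.Theory.
Local Open Scope ring_scope.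

(** The vectors 1 (x) m are killed by y_i, so y_i (f . m) = [y_i, f] m and the
theorem is the commutator formula

  [y_i, f] = t Dtau(f) c_i e_i
     - u sum_k (Ds(f) + Dsbar(f) c_k c_i) (1 + e_k e_i) s_ki
     - u sum_k (Dsbar(f) - Ds(f) c_k c_i) (1 - e_k e_i) sbar_ki

in the algebra itself, where Dtau, Ds and Dsbar are the three divided
differences ([commutator_yH_xpoly]).

Both sides are derivations in f, from the polynomials to the algebra seen as a
bimodule over them.  For the left side this is the Leibniz rule of commutators.
For the right side, a divided difference D attached to a signed permutation s
obeys the twisted rule D(f g) = f D(g) + D(f) g^s ([divdiffM]), and the element
h standing to its right satisfies h g = g^s h, which turns the twisted rule into
the plain one for f |-> D(f) h ([xderivation_divdiff]).  The elements match
their divided differences because conjugation by c_k c_i changes the signs of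
x_k and x_i, hence exchanges the actions of s_ki and sbar_ki ([tau_tau_s],
[tau_tau_sbar]): this is why Dsbar comes with c_k c_i s_ki and Ds with
c_k c_i sbar_ki.

A derivation is determined by its values on the variables ([xderivation_eq]).
On x_j with j != i only the summand k = j survives, with Ds(x_j) = -1 and
Dsbar(x_j) = 1; on x_i every divided difference is 1.  In both cases the defining
relation for [y_i, x_j] comes out ([dunkl_X]).

The computation uses nothing of the algebra H^cc_W but its relations, so it
is carried out in an arbitrary ring containing elements that satisfy them. *)

(** * Signed permutations acting on polynomials, and divided differences *)

Section Polynomials.
Set Implicit Arguments.
Unset Strict Implicit.
Variables (K : fieldType) (n : nat).
Implicit Types (a : K) (f g d : {mpoly K[n]}) (s : sperm n) (i j k : 'I_n).

Local Notation Xv := (fun j => 'X_j : {mpoly K[n]}).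

Lemma mpoly_alg_ind (P : {mpoly K[n]} -> Prop) :
  (forall a, P a%:MP_[n]) -> (forall j, P 'X_j) ->
  (forall f g, P f -> P g -> P (f + g)) ->
  (forall f g, P f -> P g -> P (f * g)) -> forall f, P f.
Proof.
move=> PC PX PD PM; elim/mpolyind=> [|c m f _ _ Pf].
  by have := PC 0; rewrite mpolyC0.
apply: PD => //; rewrite -mul_mpolyC; apply: (PM) => //.
rewrite mpolyXE_id; elim/big_ind: _ => // [|i _].
  by have := PC 1; rewrite mpolyC1.
elim: (m i) => [|k IHk]; first by have := PC 1; rewrite mpolyC1.
by rewrite exprS; apply: PM.
Qed.

Lemma pactC s a : pact s a%:MP_[n] = a%:MP.
Proof. exact: comp_mpolyC. Qed.

Lemma pactX s j : pact s 'X_j = sact Xv s j.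
Proof. by rewrite /pact comp_mpolyXU -tnth_nth tnth_mktuple. Qed.

Lemma pactD s f g : pact s (f + g) = pact s f + pact s g.
Proof. exact: comp_mpolyD. Qed.

Lemma pactB s f g : pact s (f - g) = pact s f - pact s g.
Proof. exact: comp_mpolyB. Qed.

Lemma pactZ s a f : pact s (a *: f) = a *: pact s f.
Proof. exact: comp_mpolyZ. Qed.

Lemma pactM s f g : pact s (f * g) = pact s f * pact s g.
Proof. by rewrite /pact rmorphM. Qed.

Lemma pact_pact s r f : pact s (pact r f) = pact (s * r)%g f.
Proof.
elim/mpoly_alg_ind: f => [k|j|f g IHf IHg|f g IHf IHg].
- by rewrite !pactC.
- by rewrite !pactX /sact pactZ pactX /sact scalerA /= permM ffunE signr_addb.
- by rewrite !pactD IHf IHg.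
- by rewrite !pactM IHf IHg.
Qed.

Lemma pact1 f : pact 1%g f = f.
Proof.
elim/mpoly_alg_ind: f => [k|j|f g IHf IHg|f g IHf IHg].
- by rewrite pactC.
- by rewrite pactX /sact /= perm1 ffunE scale1r.
- by rewrite !pactD IHf IHg.
- by rewrite !pactM IHf IHg.
Qed.

(** A Demazure-type operator: d stands for a linear form dividing every f - f^s. *)
Definition divdiff s d f := mquo (f - pact s f) d.

Section DividedDifference.
Variables (s : sperm n) (d : {mpoly K[n]}).
Hypothesis d0 : d != 0.

Lemma divdiffE f q : q * d = f - pact s f -> divdiff s d f = q.
Proof. exact: mquoK. Qed.

Lemma divdiffC a : divdiff s d a%:MP_[n] = 0.
Proof. by apply: divdiffE; rewrite mul0r pactC subrr. Qed.

Hypothesis dvd_d : forall f, exists q, q * d = f - pact s f.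

Lemma divdiffK f : divdiff s d f * d = f - pact s f.
Proof. by have [q qd] := dvd_d f; rewrite (divdiffE qd). Qed.

Lemma divdiffD f g : divdiff s d (f + g) = divdiff s d f + divdiff s d g.
Proof. by apply: divdiffE; rewrite mulrDl !divdiffK pactD opprD addrACA. Qed.

(** From f g - f^s g^s = f (g - g^s) + (f - f^s) g^s. *)
Lemma divdiffM f g :
  divdiff s d (f * g) = f * divdiff s d g + divdiff s d f * pact s g.
Proof.
apply: divdiffE; rewrite mulrDl -mulrA (mulrAC (divdiff s d f)) !divdiffK.
by rewrite pactM mulrBr mulrBl addrA subrK.
Qed.

End DividedDifference.

Section Roots.
Variables (i k : 'I_n).

Lemma XaddX_neq0 : k != i -> 'X_i + 'X_k != 0 :> {mpoly K[n]}.
Proof.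
move=> ki; apply/eqP=> /(congr1 (mcoeff U_(i)%MM)).
rewrite mcoeffD !mcoeffXU mcoeff0 eqxx (negbTE ki) addr0 => /eqP.
by rewrite oner_eq0.
Qed.

Lemma XsubX_neq0 : k != i -> 'X_i - 'X_k != 0 :> {mpoly K[n]}.
Proof.
move=> ki; apply/eqP=> /(congr1 (mcoeff U_(i)%MM)).
rewrite mcoeffB !mcoeffXU mcoeff0 eqxx (negbTE ki) subr0 => /eqP.
by rewrite oner_eq0.
Qed.

Lemma scaleX_neq0 (a : K) : a != 0 -> a *: 'X_i != 0 :> {mpoly K[n]}.
Proof.
move=> a0; apply/eqP=> /(congr1 (mcoeff U_(i)%MM)).
by rewrite mcoeffZ mcoeffXU mcoeff0 eqxx mulr1 => /eqP; apply/negP.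
Qed.

Lemma divdiff_s_X j : k != i ->
  divdiff (s_ k i) ('X_i - 'X_k) 'X_j = (j == i)%:R - (j == k)%:R.
Proof.
move=> ki; apply: divdiffE; first exact: XsubX_neq0.
rewrite pactX /sact /= ffunE scale1r; case: tpermP => [->|->|/eqP jk /eqP ji].
- by rewrite eqxx (negbTE ki) sub0r mulN1r opprB.
- by rewrite eqxx eq_sym (negbTE ki) subr0 mul1r.
- by rewrite (negbTE jk) (negbTE ji) subrr mul0r subrr.
Qed.

Lemma divdiff_sbar_X j : k != i ->
  divdiff (sbar_ k i) ('X_i + 'X_k) 'X_j = (j == i)%:R + (j == k)%:R.
Proof.
move=> ki; apply: divdiffE; first exact: XaddX_neq0.
rewrite pactX /sact /= ffunE !inE; case: tpermP => [->|->|/eqP jk /eqP ji].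
- by rewrite eqxx (negbTE ki) add0r mul1r scaleN1r opprK addrC.
- by rewrite eqxx eq_sym (negbTE ki) addr0 mul1r scaleN1r opprK.
- by rewrite (negbTE jk) (negbTE ji) addr0 mul0r scale1r subrr.
Qed.

Hypothesis char2 : (2 : K) != 0.

Lemma divdiff_tau_X j :
  divdiff (tau_ i) (2 *: 'X_i) 'X_j = (j == i)%:R.
Proof.
apply: divdiffE; first exact: scaleX_neq0.
rewrite pactX /sact /= perm1 ffunE; case: eqVneq => [->|_].
  by rewrite mul1r scaleN1r opprK scaler_nat mulr2n.
by rewrite mul0r scale1r subrr.
Qed.

(** Numerator and denominator of (f - f^tau) / 2 x_i are both odd in x_i.  Hence
    c_i, which changes the sign of x_i, commutes with the quotient, and c_i e_i may be
    written on either side of it. *)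
Lemma divdiff_tau_even f :
  pact (tau_ i) (divdiff (tau_ i) (2 *: 'X_i) f) =
  divdiff (tau_ i) (2 *: 'X_i) f.
Proof.
have d0 := scaleX_neq0 char2; have dvd := @pact_tau_dvd K n i.
have tau2 : (tau_ i * tau_ i = 1)%g.
  congr SPerm; rewrite /= ?mulg1 //.
  by apply/ffunP=> j; rewrite !ffunE /= perm1 addbb.
(* The image under tau_i of the equation that defines the quotient is the negative
   of the equation to be shown. *)
symmetry; apply: divdiffE => //; apply: oppr_inj; rewrite opprB.
have := congr1 (pact (tau_ i)) (divdiffK d0 dvd f).
rewrite pactM pactB pact_pact tau2 pact1 pactZ pactX /sact /= perm1 ffunE eqxx.
by rewrite scaleN1r scalerN mulrN => ->.
Qed.

End Roots.
End Polynomials.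

(** Conjugation by c_k c_i acts on the variables as tau_k tau_i; with the next lemma,
    this says that the factor c_k c_i exchanges the twists of s_ki and sbar_ki. *)
Lemma tau_tau_s (n : nat) (i k : 'I_n) : k != i ->
  (tau_ k * tau_ i * s_ k i)%g = sbar_ k i.
Proof.
move=> ki; have ik : (i == k) = false by rewrite eq_sym; apply/negbTE.
congr SPerm; rewrite /= ?mulg1 //; apply/ffunP=> j.
rewrite !ffunE /= perm1 !inE; case: tpermP => [->|->|/eqP/negbTE jk /eqP/negbTE ji].
- by rewrite !eqxx ik ?(negbTE ki).
- by rewrite !eqxx (negbTE ki) ?ik.
- by rewrite jk ji.
Qed.

Lemma tau_tau_sbar (n : nat) (i k : 'I_n) : k != i ->
  (tau_ k * tau_ i * sbar_ k i)%g = s_ k i.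
Proof.
move=> ki; have ik : (i == k) = false by rewrite eq_sym; apply/negbTE.
congr SPerm; rewrite /= ?mulg1 //; apply/ffunP=> j.
rewrite !ffunE /= perm1 !inE; case: tpermP => [->|->|/eqP/negbTE jk /eqP/negbTE ji].
- by rewrite !eqxx ik ?(negbTE ki).
- by rewrite !eqxx (negbTE ki) ?ik.
- by rewrite jk ji.
Qed.

(** * Derivations from polynomials to a ring *)

Section Evaluation.
Set Implicit Arguments.
Unset Strict Implicit.
Variables (K : fieldType) (n : nat) (H : pzRingType) (C : {rmorphism K -> H}).
Variables (x : 'I_n -> H) (X : {mpoly K[n]} -> H).
Hypothesis C_central : forall a h, C a * h = h * C a.
Hypothesis x_comm : forall i j, GRing.comm (x i) (x j).
Hypothesis XD : {morph X : f g / f + g}.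
Hypothesis XZ : forall a f, X (a *: f) = C a * X f.
Hypothesis X_monomial : forall m, X 'X_[m] = \prod_(i < n) x i ^+ m i.

(** Evaluation at commuting elements is multiplicative.  The map X is
    abstract, given by its values on monomials, so that it can be any
    presentation of the evaluation map. *)
Lemma evaluation_mul f g : X (f * g) = X f * X g.
Proof.
have X0 : X 0 = 0 by rewrite -(scale0r 0) XZ rmorph0 mul0r.
elim/mpolyind: f => [|a m f _ _ IHf]; first by rewrite !(mul0r, X0).
rewrite mulrDl !XD mulrDl IHf -scalerAl !XZ -mulrA; congr (C a * _ + _).
elim/mpolyind: g {IHf} => [|b l g _ _ IHg]; first by rewrite !(mulr0, X0).
rewrite mulrDr !XD mulrDr IHg -scalerAr !XZ; congr (_ + _).
rewrite mulrA -C_central -mulrA -mpolyXD !X_monomial; congr (_ * _).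
rewrite -prodrM_comm => [|i j _ _].
  by apply: eq_bigr => i _; rewrite mnmDE exprD.
exact/commrX/commr_sym/commrX/x_comm.
Qed.

End Evaluation.

Section Derivations.
Set Implicit Arguments.
Unset Strict Implicit.
Variables (K : fieldType) (n : nat) (H : pzRingType).
Variables (C : {rmorphism K -> H}) (X : {rmorphism {mpoly K[n]} -> H}).
Hypothesis C_central : forall a h, C a * h = h * C a.
Hypothesis XC : forall a, X a%:MP_[n] = C a.
Implicit Types (a : K) (f g d : {mpoly K[n]}) (s r : sperm n) (i j k : 'I_n).
Implicit Types (h : H) (S T : {mpoly K[n]} -> H).

(** The relation h g = g^s h, which holds for a Clifford or group element h that
    acts on the variables by s through conjugation. *)
Definition twists s h := forall f, h * X f = X (pact s f) * h.

Lemma twists_gen s h :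
  (forall j, h * X 'X_j = X (sact (fun k => 'X_k : {mpoly K[n]}) s j) * h) ->
  twists s h.
Proof.
move=> hX; elim/mpoly_alg_ind=> [a|j|f g IHf IHg|f g IHf IHg].
- by rewrite pactC XC C_central.
- by rewrite pactX hX.
- by rewrite pactD !rmorphD mulrDr mulrDl IHf IHg.
- by rewrite pactM !rmorphM mulrA IHf -!mulrA IHg.
Qed.

Lemma twists1 : twists 1%g 1.
Proof. by move=> f; rewrite pact1 mul1r mulr1. Qed.

Lemma twistsM s r h h' : twists s h -> twists r h' -> twists (s * r)%g (h * h').
Proof. by move=> hs hr f; rewrite -mulrA hr mulrA hs pact_pact mulrA. Qed.

Lemma twistsD s h h' : twists s h -> twists s h' -> twists s (h + h').
Proof. by move=> hs hr f; rewrite mulrDl hs hr mulrDr. Qed.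

Lemma twistsN s h : twists s h -> twists s (- h).
Proof. by move=> hs f; rewrite mulNr hs mulrN. Qed.

(** Derivations over the ground field into H, a bimodule over the polynomials
    through X. *)
Definition xderivation T :=
  [/\ forall a, T a%:MP_[n] = 0, {morph T : f g / f + g}
    & forall f g, T (f * g) = X f * T g + T f * X g].

Lemma xderivation_eq S T : xderivation S -> xderivation T ->
  (forall j, S 'X_j = T 'X_j) -> S =1 T.
Proof.
move=> [SC SD SM] [TC TD TM] ST.
elim/mpoly_alg_ind=> // [a|f g IHf IHg|f g IHf IHg].
- by rewrite SC TC.
- by rewrite SD TD IHf IHg.
- by rewrite SM TM IHf IHg.
Qed.

Lemma xderivationD S T : xderivation S -> xderivation T ->
  xderivation (fun f => S f + T f).
Proof.
move=> [SC SD SM] [TC TD TM]; split=> [a|f g|f g].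
- by rewrite SC TC addr0.
- by rewrite SD TD addrACA.
- by rewrite SM TM mulrDr mulrDl addrACA.
Qed.

Lemma xderivationN T : xderivation T -> xderivation (fun f => - T f).
Proof.
move=> [TC TD TM]; split=> [b|f g|f g].
- by rewrite TC oppr0.
- by rewrite TD opprD.
- by rewrite TM opprD mulrN mulNr.
Qed.

Lemma xderivationZ a T : xderivation T -> xderivation (fun f => C a * T f).
Proof.
move=> [TC TD TM]; split=> [b|f g|f g].
- by rewrite TC mulr0.
- by rewrite TD mulrDr.
- by rewrite TM mulrDr !mulrA (C_central a (X f)).
Qed.

Lemma xderivation_sum (I : finType) (P : pred I) (T : I -> {mpoly K[n]} -> H) :
  (forall l, P l -> xderivation (T l)) ->
  xderivation (fun f => \sum_(l | P l) T l f).
Proof.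
move=> TP; split=> [a|f g|f g].
- by rewrite big1 // => l /TP[-> _ _].
- by rewrite -big_split; apply: eq_bigr => l /TP[_ -> _].
- by rewrite mulr_sumr mulr_suml -big_split; apply: eq_bigr => l /TP[_ _ ->].
Qed.

Lemma xderivation_comm h : xderivation (fun f => h * X f - X f * h).
Proof.
split=> [a|f g|f g].
- by rewrite XC C_central subrr.
- by rewrite rmorphD mulrDr mulrDl opprD addrACA.
- rewrite rmorphM mulrBr mulrBl !mulrA [RHS]addrC.
  by rewrite addrA subrK.
Qed.

(** The Leibniz rule of divided differences carries g^s on the right of D(f);
    moving h across it restores g. *)
Lemma xderivation_divdiff s d h : d != 0 ->
  (forall f, exists q, q * d = f - pact s f) -> twists s h ->
  xderivation (fun f => X (divdiff s d f) * h).
Proof.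
move=> d0 dvd_d hs; split=> [a|f g|f g].
- by rewrite divdiffC // rmorph0 mul0r.
- by rewrite divdiffD // rmorphD mulrDl.
- by rewrite divdiffM // rmorphD !rmorphM mulrDl -!mulrA hs.
Qed.

(** ** The Dunkl formula as a derivation *)

Section DunklFormula.
Variables (t u : K) (i : 'I_n) (c e v vbar : 'I_n -> H) (y : H).

Local Notation Dtau f := (divdiff (tau_ i) (2 *: 'X_i) f).
Local Notation Ds k f := (divdiff (s_ k i) ('X_i - 'X_k) f).
Local Notation Dsbar k f := (divdiff (sbar_ k i) ('X_i + 'X_k) f).

Hypothesis char2 : (2 : K) != 0.
Hypothesis twists_c : forall k, twists (tau_ k) (c k).
Hypothesis twists_e : forall k, twists 1%g (e k).
Hypothesis twists_v : forall k, twists (s_ k i) (v k).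
Hypothesis twists_vbar : forall k, k != i -> twists (sbar_ k i) (vbar k).
Hypothesis c_anticomm : forall k, k != i -> c i * c k = - (c k * c i).
Hypothesis comm_yx : forall k, k != i ->
  y * X 'X_k - X 'X_k * y =
    C u * ((1 + c i * c k) * (1 + e k * e i) * v k)
    - C u * ((1 - c i * c k) * (1 - e k * e i) * vbar k).
Hypothesis comm_yx_diag :
  y * X 'X_i - X 'X_i * y =
    C t * (c i * e i)
    - C u * (\sum_(k | k != i) (1 + c k * c i) * (1 + e k * e i) * v k)
    - C u * (\sum_(k | k != i) (1 - c k * c i) * (1 - e k * e i) * vbar k).

Definition dunkl f : H :=
  C t * (X (Dtau f) * (c i * e i))
  - C u * (\sum_(k | k != i)
      (X (Ds k f) * ((1 + e k * e i) * v k)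
       + X (Dsbar k f) * (c k * c i * ((1 + e k * e i) * v k))))
  - C u * (\sum_(k | k != i)
      (X (Dsbar k f) * ((1 - e k * e i) * vbar k)
       - X (Ds k f) * (c k * c i * ((1 - e k * e i) * vbar k)))).

Lemma xderivation_dunkl : xderivation dunkl.
Proof.
have twists_ee k : twists 1%g (e k * e i).
  by rewrite -[1%g]mulg1; apply: twistsM.
have twists_v' k : twists (s_ k i) ((1 + e k * e i) * v k).
  rewrite -[s_ k i]mul1g; apply: twistsM => //.
  by apply: twistsD => //; exact: twists1.
have twists_vbar' k : k != i -> twists (sbar_ k i) ((1 - e k * e i) * vbar k).
  move=> ki; rewrite -[sbar_ k i]mul1g; apply: twistsM; last exact: twists_vbar.
  by apply: twistsD; [exact: twists1 | exact: twistsN].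
have twists_cc k : twists (tau_ k * tau_ i)%g (c k * c i) by apply: twistsM.
have derS k h : k != i -> twists (s_ k i) h ->
    xderivation (fun f => X (Ds k f) * h).
  move=> ki; apply: xderivation_divdiff (XsubX_neq0 _ ki) _.
  exact: pact_s_dvd.
have derSbar k h : k != i -> twists (sbar_ k i) h ->
    xderivation (fun f => X (Dsbar k f) * h).
  move=> ki; apply: xderivation_divdiff (XaddX_neq0 _ ki) _.
  exact: pact_sbar_dvd.
apply: xderivationD; first apply: xderivationD.
- apply/xderivationZ/(xderivation_divdiff (scaleX_neq0 _ char2)).
    exact: pact_tau_dvd.
  by rewrite -[tau_ i]mulg1; apply: twistsM.
- apply/xderivationN/xderivationZ/xderivation_sum => k ki.
  apply: xderivationD; first exact: derS.
  by apply: derSbar => //; rewrite -tau_tau_s //; apply: twistsM.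
- apply/xderivationN/xderivationZ/xderivation_sum => k ki.
  apply: xderivationD; first by apply: derSbar => //; exact: twists_vbar'.
  apply/xderivationN/derS => //; rewrite -tau_tau_sbar //; apply: twistsM => //.
  exact: twists_vbar'.
Qed.

(** The defining commutators are recovered from the values 0, 1, -1 of the divided
    differences on a variable. *)
Lemma dunkl_X j : dunkl 'X_j = y * X 'X_j - X 'X_j * y.
Proof.
rewrite /dunkl divdiff_tau_X //.
under eq_bigr => k ki do rewrite divdiff_s_X // divdiff_sbar_X //.
under [in X in _ - X]eq_bigr => k ki do
  rewrite divdiff_s_X // divdiff_sbar_X //.
have [->|ji] := eqVneq j i.
  rewrite comm_yx_diag rmorph1 mul1r.
  congr (_ - C u * _ - C u * _); apply: eq_bigr => k ki;
    rewrite eq_sym (negbTE ki) subr0 addr0 rmorph1 !mul1r -[in RHS]mulrA.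
    by rewrite [in RHS]mulrDl mul1r.
  by rewrite [in RHS]mulrBl mul1r.
rewrite comm_yx // rmorph0 mul0r mulr0 sub0r.
(* For j != i the divided differences of x_j vanish unless k = j. *)
rewrite (bigD1 j) //= big1 => [|k /andP[_ kj]]; last first.
  by rewrite (eq_sym j k) (negbTE kj) subr0 addr0 rmorph0 !mul0r addr0.
rewrite addr0 (bigD1 j) //= big1 => [|k /andP[_ kj]]; last first.
  by rewrite (eq_sym j k) (negbTE kj) subr0 addr0 rmorph0 !mul0r subr0.
rewrite addr0 eqxx sub0r add0r rmorphN rmorph1 !mulN1r !mul1r.
(* The relation is written with c_i c_j, the formula with c_j c_i. *)
rewrite c_anticomm // -[X in _ = C u * X - _]mulrA -[X in _ = _ - C u * X]mulrA.
rewrite [X in _ = C u * X - _]mulrBl [X in _ = _ - C u * X]mulrDl !mul1r.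
by rewrite -[X in X - _]mulrN opprD !opprK.
Qed.

Lemma commutator_dunkl f : y * X f - X f * y = dunkl f.
Proof.
move: f; apply: (xderivation_eq (xderivation_comm y) xderivation_dunkl) => j.
by rewrite dunkl_X.
Qed.

Lemma dunkl_scale (V : lmodType H) (m : V) f :
  dunkl f *: m =
    C t *: (X (Dtau f) *: (c i * e i *: m))
    - C u *: (\sum_(k | k != i)
        (X (Ds k f) *: ((1 + e k * e i) * v k *: m)
         + X (Dsbar k f) *: (c k * c i *: ((1 + e k * e i) * v k *: m))))
    - C u *: (\sum_(k | k != i)
        (X (Dsbar k f) *: ((1 - e k * e i) * vbar k *: m)
         - X (Ds k f) *: (c k * c i *: ((1 - e k * e i) * vbar k *: m)))).
Proof.
rewrite /dunkl !scalerBl -!scalerA !scaler_suml.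
congr (_ - C u *: _ - C u *: _); apply: eq_bigr => k _.
  by rewrite scalerDl -!scalerA.
by rewrite scalerBl -!scalerA.
Qed.

End DunklFormula.
End Derivations.

(** * Relations between the generators *)

Section RelationImages.
Set Implicit Arguments.
Unset Strict Implicit.
Variables (K : fieldType) (F : lalgType K) (S : pzRingType).
Variables (phi : {rmorphism F -> S}) (C : K -> S).
Hypothesis phiZ : forall a b, phi (a *: b) = C a * phi b.

(** The defining relations hold between expressions in the free algebra; these two
    lemmas distribute the quotient map over them.  Only a ring is asked of the target,
    scalars being carried there by C, because a presented algebra has its scalars
    as central elements and not as a module structure. *)
Lemma image_yx (u : K) (x y ci cj ei ej v vbar : F) :
  phi (y * x - x * y) =
    phi (u *: ((1 + ci * cj) * (1 + ej * ei) * v)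
         - u *: ((1 - ci * cj) * (1 - ej * ei) * vbar)) ->
  phi y * phi x - phi x * phi y =
    C u * ((1 + phi ci * phi cj) * (1 + phi ej * phi ei) * phi v)
    - C u * ((1 - phi ci * phi cj) * (1 - phi ej * phi ei) * phi vbar).
Proof.
by rewrite !(rmorphB, phiZ) /= !(rmorphM, rmorphB, rmorphD, rmorph1) /=.
Qed.

Lemma image_yx_diag (t u : K) (I : finType) (P : pred I)
    (x y ci ei : F) (c e v vbar : I -> F) :
  phi (y * x - x * y) =
    phi (t *: (ci * ei)
      - u *: (\sum_(k | P k) (1 + c k * ci) * (1 + e k * ei) * v k)
      - u *: (\sum_(k | P k) (1 - c k * ci) * (1 - e k * ei) * vbar k)) ->
  phi y * phi x - phi x * phi y =
    C t * (phi ci * phi ei)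
    - C u * (\sum_(k | P k)
               (1 + phi (c k) * phi ci) * (1 + phi (e k) * phi ei) * phi (v k))
    - C u * (\sum_(k | P k)
               (1 - phi (c k) * phi ci) * (1 - phi (e k) * phi ei)
               * phi (vbar k)).
Proof.
rewrite !(rmorphB, phiZ) /= !rmorphM /= !rmorph_sum /= => ->.
congr (_ - C u * _ - C u * _); apply: eq_bigr => k _.
  by rewrite !(rmorphM, rmorphD, rmorph1) /=.
by rewrite !(rmorphM, rmorphB, rmorph1) /=.
Qed.

End RelationImages.

Section Hcc.
Set Implicit Arguments.
Unset Strict Implicit.
Variables (K : fieldType) (n : nat) (t u : K).
Implicit Types (a : K) (s : WD n) (i j k : 'I_n).

Local Notation H := (hcc n t u).
Local Notation pi := (palg_pi (hcc_relators n t u)).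
Local Notation C := (palgC (hcc_relators n t u)).
Local Notation x := (xH t u).
Local Notation y := (yH t u).
Local Notation c i := (cwH t u (GenC i)).
Local Notation e i := (cwH t u (GenE i)).
Local Notation w s := (cwH t u (GenW s)).

Lemma hcc_piM (a b : free_alg K (hcc_gen n)) : pi (a * b) = pi a * pi b :> H.
Proof. exact: rmorphM. Qed.

Lemma hcc_piZ a (b : free_alg K (hcc_gen n)) :
  pi (a *: b) = C a * pi b.
Proof. by rewrite /palgC -rmorphM /= -scalerAl mul1r. Qed.

Lemma xH_comm i j : x i * x j = x j * x i.
Proof. by rewrite /xH /palg_gen -!hcc_piM; apply/palg_pi_rel/hcc_xx. Qed.

Lemma wH_xH s j :
  w s * x j = C ((-1) ^+ sp_sign (sgval s) j) * x (sp_perm (sgval s) j) * w s.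
Proof.
rewrite /xH /cwH /palg_gen -hcc_piZ -!hcc_piM.
exact/palg_pi_rel/hcc_wx.
Qed.

Lemma eH_xH i j : e i * x j = x j * e i.
Proof. by rewrite /xH /cwH /palg_gen -!hcc_piM; apply/palg_pi_rel/hcc_ex. Qed.

Lemma cH_xH i j : c i * x j = C ((-1) ^+ (j == i)) * x j * c i.
Proof.
rewrite /xH /cwH /palg_gen -hcc_piZ -!hcc_piM -scalerAl eq_sym.
exact/palg_pi_rel/hcc_cx.
Qed.

Lemma cH_anticomm i j : i != j -> c i * c j = - (c j * c i).
Proof.
move=> ij; rewrite /cwH /palg_gen -!hcc_piM -rmorphN.
exact/palg_pi_rel/hcc_cliffW/cliffW_ccN.
Qed.

Lemma yH_xH i j : i != j ->
  y i * x j - x j * y i =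
    C u * ((1 + c i * c j) * (1 + e j * e i) * w (sW i j))
    - C u * ((1 - c i * c j) * (1 - e j * e i) * w (sbarW i j)).
Proof.
move=> ij.
exact (image_yx hcc_piZ
  (palg_pi_rel (hcc_yx t u _ _ _ _ _ ij : hcc_relators n t u _ _))).
Qed.

Lemma yH_xH_diag i :
  y i * x i - x i * y i =
    C t * (c i * e i)
    - C u * (\sum_(k | k != i) (1 + c k * c i) * (1 + e k * e i) * w (sW k i))
    - C u * (\sum_(k | k != i)
               (1 - c k * c i) * (1 - e k * e i) * w (sbarW k i)).
Proof.
exact (image_yx_diag hcc_piZ
  (palg_pi_rel (hcc_yx_diag t u _ _ _ _ _ i : hcc_relators n t u _ _))).
Qed.

End Hcc.

(** * The commutator of y_i with a polynomial *)

Section XpolyMorphism.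
Set Implicit Arguments.
Unset Strict Implicit.
Variables (K : fieldType) (n : nat) (t u : K).
Implicit Types (a : K) (f g : {mpoly K[n]}) (i j k : 'I_n).

Local Notation H := (hcc n t u).
Local Notation C := (palgC (hcc_relators n t u)).
Local Notation X := (@xpoly K n t u).
Local Notation x := (xH t u).

Lemma xpoly_monomial m : X 'X_[m] = \prod_(i < n) x i ^+ m i.
Proof. by rewrite /xpoly msuppX big_seq1 mcoeffX eqxx rmorph1 mul1r. Qed.

Lemma xpolyX j : X 'X_j = x j.
Proof.
rewrite xpoly_monomial.
(* The ring is not commutative, so x_j is isolated by turning the product into one
   over the single index j rather than by moving factors. *)
transitivity (\prod_(i < n) (if i == j then x i else 1)).
  by apply: eq_bigr => i _; rewrite mnm1E eq_sym; case: eqP.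
by rewrite -big_mkcond big_pred1_eq.
Qed.

Lemma xpolyZ a f : X (a *: f) = C a * X f.
Proof. by rewrite -mul_mpolyC mulrC xpolyM palgC_central. Qed.

Fact xpoly_is_monoid_morphism : monoid_morphism X.
Proof.
split=> [|f g].
  by rewrite -mpolyX0 xpoly_monomial big1 // => i _; rewrite mnm0E.
apply: (@evaluation_mul K n H C x X) => [a h|i j|{}f {}g|a {}f|m].
- exact: palgC_central.
- exact: xH_comm.
- exact: xpolyD.
- exact: xpolyZ.
- exact: xpoly_monomial.
Qed.

Fact xpoly_is_zmod_morphism : zmod_morphism X.
Proof.
move=> f g; rewrite xpolyD -scaleN1r xpolyZ rmorphN1.
by congr (_ + _); exact: mulN1r.
Qed.

HB.instance Definition _ :=
  GRing.isZmodMorphism.Build {mpoly K[n]} H X xpoly_is_zmod_morphism.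
HB.instance Definition _ :=
  GRing.isMonoidMorphism.Build {mpoly K[n]} H X xpoly_is_monoid_morphism.

Lemma xpolyC a : X a%:MP_[n] = C a.
Proof.
rewrite -[a%:MP_[n]]mul1r xpolyM -mpolyX0 xpoly_monomial big1 ?mul1r // => i _.
by rewrite mnm0E.
Qed.

Local Notation c i := (cwH t u (GenC i)).
Local Notation e i := (cwH t u (GenE i)).
Local Notation w s := (cwH t u (GenW s)).
Local Notation twists := (@twists K n H X).

Lemma twists_cH i : twists (tau_ i) (c i).
Proof.
apply: (twists_gen (@palgC_central _ _ _) xpolyC) => j.
by rewrite /sact /= perm1 ffunE /= xpolyZ !xpolyX cH_xH.
Qed.

Lemma twists_eH i : twists 1%g (e i).
Proof.
apply: (twists_gen (@palgC_central _ _ _) xpolyC) => j.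
by rewrite /sact /= perm1 ffunE /= xpolyZ !xpolyX eH_xH rmorph1 mul1r.
Qed.

Lemma twists_wH (s : WD n) : twists (sgval s) (w s).
Proof.
apply: (twists_gen (@palgC_central _ _ _) xpolyC) => j.
by rewrite /sact /= xpolyZ !xpolyX wH_xH.
Qed.

Lemma sWC i k : sW i k = sW k i.
Proof. by rewrite /sW /s_ tpermC. Qed.

Lemma sbarWC i k : sbarW i k = sbarW k i.
Proof. by rewrite /sbarW /sbar_ tpermC finset.setUC. Qed.

Lemma commutator_yH_xpoly i f : (2 : K) != 0 ->
  yH t u i * X f - X f * yH t u i =
    dunkl C X t u i (fun k => c k) (fun k => e k)
      (fun k => w (sW k i)) (fun k => w (sbarW k i)) f.
Proof.
move=> char2.
apply: (commutator_dunkl (@palgC_central _ _ _) xpolyC char2 twists_cH twists_eH).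
- by move=> k; rewrite -[s_ k i](subgK _ (s_in_WD k i)); exact: twists_wH.
- move=> k ki; rewrite -[sbar_ k i](subgK _ (sbar_in_WD ki)); exact: twists_wH.
- by move=> k ki; apply: cH_anticomm; rewrite eq_sym.
- move=> k ki; rewrite /= xpolyX -(sWC i k) -(sbarWC i k).
  by apply: yH_xH; rewrite eq_sym.
- by rewrite /= xpolyX; exact: yH_xH_diag.
Qed.

End XpolyMorphism.

(** * The action on the induced module *)

Section LinearAlgebra.
Set Implicit Arguments.
Unset Strict Implicit.

Lemma scale_commutator (A : pzRingType) (V : lmodType A) (h p : A) (v : V) :
  h *: v = 0 -> h *: (p *: v) = (h * p - p * h) *: v.
Proof. by move=> hv; rewrite scalerBl -!scalerA hv scaler0 subr0. Qed.

(** The shape of the right-hand side of the theorem, pushed through a map that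
    matches the scalars iota k with the scalars sigma k. *)
Lemma semilinear_combination (K : Type) (A B : pzRingType) (V : lmodType A)
    (W : lmodType B) (iota : K -> A) (sigma : K -> B) (phi : {additive V -> W})
    (I : finType) (P : pred I) (a b : K) (p : V) (q r : I -> V) :
  (forall k v, phi (iota k *: v) = sigma k *: phi v) ->
  phi (iota a *: p - iota b *: (\sum_(l | P l) q l)
                   - iota b *: (\sum_(l | P l) r l)) =
  sigma a *: phi p - sigma b *: (\sum_(l | P l) phi (q l))
                   - sigma b *: (\sum_(l | P l) phi (r l)).
Proof. by move=> phiZ; rewrite !raddfB /= !phiZ !raddf_sum. Qed.

End LinearAlgebra.

Section DunklOperators.
Set Implicit Arguments.
Unset Strict Implicit.
Variables (K : fieldType) (n : nat) (t u : K) (M : lmodType (cliffW K n)).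
Variable E : y_extension t u M.
Implicit Types (a : K) (f g : {mpoly K[n]}) (i j k : 'I_n) (m : M).
Implicit Types (h : hcc n t u) (b : cliffW K n).

Local Notation C := (palgC (hcc_relators n t u)).
Local Notation X := (@xpoly K n t u).
Local Notation cH i := (cwH t u (GenC i)).
Local Notation eH i := (cwH t u (GenE i)).
Local Notation wH s := (cwH t u (GenW s)).
Local Notation c := (@cC K n).
Local Notation e := (@eC K n).
Local Notation w := (@wC K n).

HB.instance Definition _ := GRing.isZmodMorphism.Build _ _ (ident E) (identB E).

(** The scalars t and u act on the two sides through different rings, as constant
    polynomials and as central elements of H^cc_W. *)
Lemma identZ a p : ident E (a%:MP *: p) = C a *: ident E p.
Proof.
elim/tensor_ind: p => [|f m|p q IHp IHq]; first by rewrite !(scaler0, raddf0).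
- rewrite -[tensor _ f m]/(ptensor f m) identE.
  have -> : a%:MP *: ptensor f m = ptensor (a *: f) m.
    by rewrite /ptensor tensorZ mul_mpolyC.
  by rewrite identE xpolyZ scalerA.
- by rewrite !(scalerBr, raddfB) /= IHp IHq.
Qed.

(** h and b are the images of one element of the smash product in H^cc_W and in the
    algebra acting on M; this replaces a morphism between the two presented
    algebras. *)
Definition ind_acts h b := forall m, h *: ind E m = ind E (b *: m).

Lemma ind_acts_gen (s : cliffW_gen n) :
  ind_acts (cwH t u s) (palg_gen (cliffW_relators K n) s).
Proof. by move=> m; rewrite ind_cw. Qed.

Lemma ind_acts1 : ind_acts 1 1.
Proof. by move=> m; rewrite !scale1r. Qed.

Lemma ind_actsM h h' b b' :
  ind_acts h b -> ind_acts h' b' -> ind_acts (h * h') (b * b').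
Proof. by move=> hb hb' m; rewrite -!scalerA hb' hb. Qed.

Lemma ind_actsD h h' b b' :
  ind_acts h b -> ind_acts h' b' -> ind_acts (h + h') (b + b').
Proof. by move=> hb hb' m; rewrite !scalerDl indD hb' hb. Qed.

Lemma ind_actsN h b : ind_acts h b -> ind_acts (- h) (- b).
Proof.
move=> hb m; rewrite !scaleNr hb; apply: (addIr (ind E (b *: m))).
by rewrite -indD !addNr; symmetry; exact: tensor0r.
Qed.

Lemma ident_ptensor h b f m :
  ind_acts h b -> X f *: (h *: ind E m) = ident E (ptensor f (b *: m)).
Proof. by move=> hb; rewrite hb identE. Qed.

Lemma ident_ptensor_r h h' b b' f m : ind_acts h b -> ind_acts h' b' ->
  X f *: (h *: (h' *: ind E m)) = ident E (ptensor_r f b (b' *: m)).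
Proof. by move=> hb hb'; rewrite hb'; exact: ident_ptensor. Qed.

Local Notation Dtau i f := (divdiff (tau_ i) (2 *: 'X_i) f).
Local Notation Ds i k f := (divdiff (s_ k i) ('X_i - 'X_k) f).
Local Notation Dsbar i k f := (divdiff (sbar_ k i) ('X_i + 'X_k) f).

(** The theorem over any field in which the denominator 2 x_i is nonzero. *)
Lemma yH_ident i f m : (2 : K) != 0 ->
  yH t u i *: ident E (ptensor f m) =
  ident E (
    t%:MP *: ce_ptensor i (Dtau i f) m
    - u%:MP *: (\sum_(k | k != i)
        (ptensor (Ds i k f) ((1 + e k * e i) * w (sW k i) *: m)
         + ptensor_r (Dsbar i k f) (c k * c i)
             ((1 + e k * e i) * w (sW k i) *: m)))
    - u%:MP *: (\sum_(k | k != i)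
        (ptensor (Dsbar i k f) ((1 - e k * e i) * w (sbarW k i) *: m)
         - ptensor_r (Ds i k f) (c k * c i)
             ((1 - e k * e i) * w (sbarW k i) *: m)))).
Proof.
move=> char2.
have acts_c k : ind_acts (cH k) (c k) by exact: ind_acts_gen.
have acts_e k : ind_acts (eH k) (e k) by exact: ind_acts_gen.
have acts_w s : ind_acts (wH s) (w s) by exact: ind_acts_gen.
have acts_ee k : ind_acts (eH k * eH i) (e k * e i) by exact: ind_actsM.
have acts_cc k : ind_acts (cH k * cH i) (c k * c i) by exact: ind_actsM.
have acts_s k : ind_acts ((1 + eH k * eH i) * wH (sW k i))
    ((1 + e k * e i) * w (sW k i)).
  by apply: ind_actsM => //; apply: ind_actsD => //; exact: ind_acts1.
have acts_sbar k : ind_acts ((1 - eH k * eH i) * wH (sbarW k i))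
    ((1 - e k * e i) * w (sbarW k i)).
  apply: ind_actsM => //; apply: ind_actsD; first exact: ind_acts1.
  exact: ind_actsN.
rewrite identE (scale_commutator (X f) (ind_y E i m)) commutator_yH_xpoly //.
etransitivity; first exact: dunkl_scale.
rewrite /ce_ptensor divdiff_tau_even //.
rewrite [RHS](semilinear_combination _ _ _ _ _ _ identZ).
congr (C t *: _ - C u *: _ - C u *: _).
- by apply: ident_ptensor; exact: ind_actsM.
- apply: eq_bigr => k _; rewrite [RHS]raddfD; congr (_ + _).
    exact: ident_ptensor (acts_s k).
  exact: ident_ptensor_r (acts_cc k) (acts_s k).
- apply: eq_bigr => k _; rewrite [RHS]raddfB; congr (_ - _).
    exact: ident_ptensor (acts_sbar k).
  exact: ident_ptensor_r (acts_cc k) (acts_sbar k).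
Qed.

End DunklOperators.

Theorem theorem3p16 (R : realType) (n : nat) (t u : R[i])
    (M : lmodType (cliffW R[i] n)) (E : y_extension t u M)
    (i : 'I_n) (f : {mpoly R[i][n]}) (m : M) :
  let c := @cC R[i] n in
  let e := @eC R[i] n in
  let w := @wC R[i] n in
  let Dtau := mquo (f - pact (tau_ i) f) (2 *: 'X_i) in
  let Ds k := mquo (f - pact (s_ k i) f) ('X_i - 'X_k) in
  let Dsbar k := mquo (f - pact (sbar_ k i) f) ('X_i + 'X_k) in
  yH t u i *: ident E (ptensor f m) =
  ident E (
    t%:MP *: ce_ptensor i Dtau m
    - u%:MP *: (\sum_(k < n | k != i)
        (ptensor (Ds k) ((1 + e k * e i) * w (sW k i) *: m)
         + ptensor_r (Dsbar k) (c k * c i)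
             ((1 + e k * e i) * w (sW k i) *: m)))
    - u%:MP *: (\sum_(k < n | k != i)
        (ptensor (Dsbar k) ((1 - e k * e i) * w (sbarW k i) *: m)
         - ptensor_r (Ds k) (c k * c i)
             ((1 - e k * e i) * w (sbarW k i) *: m)))).
Proof. by apply: yH_ident; rewrite Num.Theory.pnatr_eq0. Qed.
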